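(* Let $G=(V,E,W)$ be an undirected matrix-weighted graph with $n$ vertices $v_1,\ldots,v_n$ and symmetric positive semidefinite matrix weights $\mathbf{A}_{ij}=\mathbf{A}_{ij}^\top=\mathbf{A}_{ji}\in\mathbb{R}^{d\times d}$, and let $\mathbf{M}(G,k)$, $k\ge 0$, be defined as in the context. Then: (i) Two vertices $v_i,v_j\in V$ belong to the same cluster if there exists $k\le n-1$ such that the $ij$-th $d\times d$ block of $\mathbf{M}(G,k)$ satisfies $[\mathbf{M}(G,k)]_{ij}=\mathbf{I}_d$. (ii) The graph $G$ is connected if $\mathbf{M}(G,n-1)=\mathbf{1}_n\mathbf{1}_n^\top\otimes\mathbf{I}_d$. If there is no path joining $v_i$ to $v_j$, then $[\mathbf{M}(G,n-1)]_{ij}=[\mathbf{M}(G,n-1)]_{ji}=\mathbf{0}_{d\times d}$.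
   Context: The graph has no self-loops and no multi-edges. Its block adjacency matrix is $\mathbf{A}=[\mathbf{A}_{ij}]\in\mathbb{R}^{dn\times dn}$ with $\mathbf{A}_{ij}=\mathbf{0}_{d\times d}$ if $(v_i,v_j)\notin E$ or $i=j$. The matrix-weighted Laplacian is $\mathbf{L}=\mathbf{D}-\mathbf{A}$ with $\mathbf{D}=\mathrm{blkdiag}(\mathbf{D}_1,\ldots,\mathbf{D}_n)$, $\mathbf{D}_i=\sum_{j}\mathbf{A}_{ij}$; $G$ is connected if $\mathrm{rank}(\mathbf{L})=dn-d$. Vertices $v_i,v_j$ belong to the same cluster if every $\mathbf{x}=[\mathbf{x}_1^\top,\ldots,\mathbf{x}_n^\top]^\top\in\ker(\mathbf{L})$ satisfies $\mathbf{x}_i=\mathbf{x}_j$. Operations on symmetric positive semidefinite $d\times d$ matrices: series sum $\mathbf{A}_1\vee\mathbf{A}_2=\mathbf{A}_1+\mathbf{A}_2$; parallel sum $\mathbf{A}_1\wedge\mathbf{A}_2=\mathbf{A}_1(\mathbf{A}_1+\mathbf{A}_2)^{\dagger}\mathbf{A}_2$ ($\dagger$ = Moore–Penrose pseudoinverse). Decision operator: $\mathcal{D}(\mathbf{X})=\mathbf{I}_d$ if $\mathrm{rank}(\mathbf{X})=d$, $\mathcal{D}(\mathbf{X})=\mathbf{0}_{d\times d}$ if $\mathbf{X}=\mathbf{0}_{d\times d}$, and $\mathcal{D}(\mathbf{X})=\mathbf{X}$ otherwise; for a block matrix $\mathcal{D}([\mathbf{X}_{ij}])=[\mathcal{D}(\mathbf{X}_{ij})]$.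 For block matrices $\mathbf{X}=[\mathbf{X}_{ij}],\mathbf{Y}=[\mathbf{Y}_{ij}]\in\mathbb{R}^{dn\times dn}$ with $d\times d$ symmetric positive semidefinite blocks: $(\mathbf{X}\wedge\mathbf{Y})_{ij}=\sum_{k=1}^n(\mathbf{X}_{ik}\wedge\mathbf{Y}_{kj})$ and $(\mathbf{X}\vee\mathbf{Y})_{ij}=\mathbf{X}_{ij}+\mathbf{Y}_{ij}$. Powers: $\mathbf{A}^0=\mathbf{I}_{dn}$, $\mathbf{A}^1=\mathcal{D}(\mathbf{A})$, $\mathbf{A}^k=\mathcal{D}(\mathbf{A}^{k-1}\wedge\mathcal{D}(\mathbf{A}))$ for $k\ge2$. Finally $\mathbf{M}(G,0)=\mathbf{I}_{dn}$ and $\mathbf{M}(G,k)=\mathcal{D}(\mathbf{M}(G,k-1)\vee\mathbf{A}^k)$ for $k\ge1$. *)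

(* Defs.v *)
From HB Require Import structures.
From mathcomp Require Import all_boot all_order all_algebra.
From mathcomp Require Import boolp classical_sets reals.

Set Implicit Arguments.
Unset Strict Implicit.
Unset Printing Implicit Defensive.

Import Order.TTheory GRing.Theory Num.Theory.
Local Open Scope ring_scope.

Definition psdmx (R : realType) (d : nat) (X : 'M[R]_d) : Prop :=
  X^T = X /\ forall x : 'cV[R]_d, 0 <= (x^T *m X *m x) 0 0.

(* The four Penrose equations. *)
Definition is_mpinv (R : realType) (m n : nat)
    (X : 'M[R]_(m, n)) (Y : 'M[R]_(n, m)) : Prop :=
  [/\ X *m Y *m X = X, Y *m X *m Y = Y,
      (X *m Y)^T = X *m Y & (Y *m X)^T = Y *m X].

(* Not [pinvmx], which is only a generalized inverse. The default value 0 is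
   never taken, see [mpinvP]. *)
Definition mpinv (R : realType) (m n : nat) (X : 'M[R]_(m, n)) : 'M[R]_(n, m) :=
  xget 0 (fun Y => is_mpinv X Y).

Lemma gram_unit (R : realType) (r n : nat) (F : 'M[R]_(r, n)) :
  row_free F -> F *m F^T \in unitmx.
Proof.
move=> Ff; rewrite -row_free_unit -kermx_eq0; apply/eqP/row_matrixP => i.
rewrite row0; set u := row i _.
have uG : u *m (F *m F^T) = 0.
  by apply/sub_kermxP; rewrite /u row_sub.
have w0 : (u *m F) *m (u *m F)^T = 0.
  by rewrite trmx_mul !mulmxA -(mulmxA u) uG mul0mx.
have uF : u *m F = 0.
  apply/rowP => j; rewrite [RHS]mxE.
  move/matrixP/(_ 0 0): w0; rewrite mxE [RHS]mxE => /eqP.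
  rewrite psumr_eq0 => [/allP/(_ j)|k _]; last by rewrite [_^T _ _]mxE -expr2 sqr_ge0.
  by rewrite mem_index_enum => /(_ isT); rewrite [_^T _ _]mxE mulf_eq0 orbb => /eqP.
by apply: (row_free_inj Ff); rewrite uF mul0mx.
Qed.

Lemma mpinv_exists (R : realType) (m n : nat) (X : 'M[R]_(m, n)) :
  exists Y, is_mpinv X Y.
Proof.
have [r [C [F [XE Cf Ff]]]] : exists r (C : 'M[R]_(m, r)) (F : 'M[R]_(r, n)),
    [/\ X = C *m F, row_free C^T & row_free F].
  exists (\rank X), (col_base X), (row_base X); split; rewrite ?mulmx_base //.
    by rewrite /row_free mxrank_tr; have := col_base_full X.
  exact: row_base_free.
have uF := gram_unit Ff; have := gram_unit Cf; rewrite trmxK => uC.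
set GF := F *m F^T in uF; set GC := C^T *m C in uC.
have GFs : (invmx GF)^T = invmx GF by rewrite trmx_inv trmx_mul trmxK.
have GCs : (invmx GC)^T = invmx GC by rewrite trmx_inv trmx_mul trmxK.
exists (F^T *m invmx GF *m (invmx GC *m C^T)).
have XY : X *m (F^T *m invmx GF *m (invmx GC *m C^T)) = C *m invmx GC *m C^T.
  by rewrite XE !mulmxA -(mulmxA C) -/GF -(mulmxA C) mulmxV // mulmx1.
have YX : F^T *m invmx GF *m (invmx GC *m C^T) *m X = F^T *m invmx GF *m F.
  by rewrite XE !mulmxA -(mulmxA _ C^T) -/GC -(mulmxA _ _ GC) mulVmx // mulmx1.
split.
- by rewrite XY XE !mulmxA -(mulmxA _ C^T) -/GC -(mulmxA _ _ GC) mulVmx // mulmx1.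
- by rewrite YX !mulmxA -(mulmxA _ F) -/GF -(mulmxA _ _ GF) mulVmx // mulmx1.
- by rewrite XY !trmx_mul trmxK GCs !mulmxA.
- by rewrite YX !trmx_mul trmxK GFs !mulmxA.
Qed.

Lemma mpinvP (R : realType) (m n : nat) (X : 'M[R]_(m, n)) :
  is_mpinv X (mpinv X).
Proof. exact: xgetPex (mpinv_exists X). Qed.

Lemma mpinv_uniq (R : realType) (m n : nat) (X : 'M[R]_(m, n)) Y Z :
  is_mpinv X Y -> is_mpinv X Z -> Y = Z.
Proof.
move=> [y1 y2 y3 y4] [z1 z2 z3 z4].
have E1 : X *m Y = X *m Z.
  by rewrite -[LHS]y3 -[in LHS]z1 -mulmxA trmx_mul y3 z3 !mulmxA y1.
have E2 : Y *m X = Z *m X.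
  by rewrite -[LHS]y4 -[in LHS]z1 -!mulmxA mulmxA trmx_mul y4 z4 -!mulmxA [X *m _]mulmxA y1.
by rewrite -y2 E2 -mulmxA E1 mulmxA z2.
Qed.

Definition series_sum (R : realType) (d : nat) (X Y : 'M[R]_d) : 'M[R]_d := X + Y.

Definition parallel_sum (R : realType) (d : nat) (X Y : 'M[R]_d) : 'M[R]_d :=
  X *m mpinv (X + Y) *m Y.

Definition decision (R : realType) (d : nat) (X : 'M[R]_d) : 'M[R]_d :=
  if \rank X == d then 1%:M else if X == 0 then 0 else X.

(* dn x dn matrices, indexed so that they split into n x n blocks of size d. *)
Definition blkmx (R : realType) (n d : nat) : Type := 'M[R]_(\sum_(i < n) d).

Definition block (R : realType) (n d : nat) (X : blkmx R n d) (i j : 'I_n) :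
    'M[R]_d :=
  @submxblock R n n (fun=> d) (fun=> d) X i j.

Definition of_blocks (R : realType) (n d : nat) (B : 'I_n -> 'I_n -> 'M[R]_d) :
    blkmx R n d :=
  \mxblock_(i < n, j < n) B i j.

Definition blk_series (R : realType) (n d : nat) (X Y : blkmx R n d) :
    blkmx R n d :=
  of_blocks (fun i j => series_sum (block X i j) (block Y i j)).

Definition blk_parallel (R : realType) (n d : nat) (X Y : blkmx R n d) :
    blkmx R n d :=
  of_blocks (fun i j => \sum_(k < n) parallel_sum (block X i k) (block Y k j)).

Definition blk_decision (R : realType) (n d : nat) (X : blkmx R n d) :
    blkmx R n d :=
  of_blocks (fun i j => decision (block X i j)).

Fixpoint blk_power (R : realType) (n d : nat) (X : blkmx R n d) (k : nat) :
    blkmx R n d :=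
  match k with
  | 0 => 1%:M
  | 1 => blk_decision X
  | (_.+1 as k').+1 => blk_decision (blk_parallel (blk_power X k') (blk_decision X))
  end.

(* Kronecker product of an n x n matrix with a d x d matrix. *)
Definition kron (R : realType) (n d : nat) (P : 'M[R]_n) (Q : 'M[R]_d) :
    blkmx R n d :=
  of_blocks (fun i j => P i j *: Q).

(* The weight of an edge is allowed to vanish. *)
Record mwgraph (R : realType) (n d : nat) := MWGraph {
  edge : rel 'I_n;
  weight : 'I_n -> 'I_n -> 'M[R]_d;
  edge_sym : symmetric edge;
  edge_irr : irreflexive edge;
  weight_sym : forall i j, weight i j = weight j i;
  weight_psd : forall i j, psdmx (weight i j);
  weight_nonedge : forall i j, ~~ edge i j -> weight i j = 0
}.

Definition adjacency (R : realType) (n d : nat) (G : mwgraph R n d) :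
    blkmx R n d :=
  of_blocks (weight G).

Definition degree (R : realType) (n d : nat) (G : mwgraph R n d) : blkmx R n d :=
  \mxdiag_(i < n) (\sum_(j < n) weight G i j).

Definition laplacian (R : realType) (n d : nat) (G : mwgraph R n d) :
    blkmx R n d :=
  degree G - adjacency G.

Definition mw_connected (R : realType) (n d : nat) (G : mwgraph R n d) : Prop :=
  \rank (laplacian G) = (d * n - d)%N.

Definition same_cluster (R : realType) (n d : nat) (G : mwgraph R n d)
    (i j : 'I_n) : Prop :=
  forall x : 'cV[R]_(\sum_(i < n) d), laplacian G *m x = 0 ->
    @submxcol R n (fun=> d) 1 x i = @submxcol R n (fun=> d) 1 x j.

(* The one-vertex path (p = [::]) joins every vertex to itself. *)
Definition path_joins (R : realType) (n d : nat) (G : mwgraph R n d)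
    (i j : 'I_n) : Prop :=
  exists p : seq 'I_n, [/\ path (edge G) i p, uniq (i :: p) & last i p = j].

Fixpoint Mmx (R : realType) (n d : nat) (G : mwgraph R n d) (k : nat) :
    blkmx R n d :=
  match k with
  | 0 => 1%:M
  | k'.+1 => blk_decision (blk_series (Mmx G k') (blk_power (adjacency G) k))
  end.

(* Main.v *)
(* If x is in the kernel of the Laplacian, its Dirichlet energy
   \sum_(i, j) (x_i - x_j)^T A_ij (x_i - x_j) vanishes, so A_ij kills x_i - x_j.
   The property "the block (i, j) is positive semidefinite and kills x_i - x_j"
   is preserved by the decision operator, by series sums, and, writing
   x_i - x_j = (x_i - x_k) + (x_k - x_j), by parallel sums, since the kernel of
   a parallel sum contains both kernels. Hence it holds for all blocks of
   M(G, k), and a block equal to I_d forces x_i = x_j. If this happens for all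
   i and j, the kernel of the Laplacian is the d-dimensional space of consensus
   vectors. Likewise, the property "the block (i, j) vanishes unless i and j are
   joined by a path" is preserved by all these operations. *)

Require Import Defs.
From mathcomp Require Import all_boot all_order all_algebra.
From mathcomp Require Import reals ring.
Set Implicit Arguments.
Unset Strict Implicit.
Unset Printing Implicit Defensive.
Import Order.TTheory GRing.Theory Num.Theory.
Local Open Scope ring_scope.

Section SquaredNorm.
Context {R : realDomainType} {m : nat}.
Implicit Type x : 'cV[R]_m.

Lemma cV_sqnormE x : (x^T *m x) 0 0 = \sum_i x i 0 ^+ 2.
Proof. by rewrite mxE; apply: eq_bigr => i _; rewrite mxE expr2. Qed.

Lemma cV_sqnorm_ge0 x : 0 <= (x^T *m x) 0 0.
Proof. by rewrite cV_sqnormE sumr_ge0 // => i _; rewrite sqr_ge0. Qed.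

Lemma cV_sqnorm_eq0 x : ((x^T *m x) 0 0 == 0) = (x == 0).
Proof.
rewrite cV_sqnormE psumr_eq0 => [|i _]; last exact: sqr_ge0.
apply/allP/eqP => [x0|-> i _]; last by rewrite /= mxE expr0n eqxx.
apply/colP => i; apply/eqP; rewrite mxE -sqrf_eq0.
by have := x0 i (mem_index_enum i).
Qed.

End SquaredNorm.

Definition mxform (R : pzSemiRingType) (m n : nat) (X : 'M[R]_(m, n))
    (x : 'cV[R]_m) (y : 'cV[R]_n) : R :=
  (x^T *m X *m y) 0 0.

Section MatrixForm.
Context {R : comPzRingType} {m n : nat}.
Implicit Types X Y : 'M[R]_(m, n).

Lemma mxformE X x y : mxform X x y = (x^T *m (X *m y)) 0 0.
Proof. by rewrite mulmxA. Qed.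

Lemma mxform_tr X x y : mxform X^T y x = mxform X x y.
Proof. by rewrite mxformE /mxform -[x in LHS]trmxK -!trmx_mul mxE. Qed.

Lemma mxform_congr p q X (B : 'M_(m, p)) (C : 'M_(n, q)) u v :
  mxform (B^T *m X *m C) u v = mxform X (B *m u) (C *m v).
Proof. by rewrite /mxform trmx_mul !mulmxA. Qed.

Lemma mxformD X Y x y : mxform (X + Y) x y = mxform X x y + mxform Y x y.
Proof. by rewrite !mxformE mulmxDl mulmxDr mxE. Qed.

Lemma mxformBl X x y z : mxform X (x - y) z = mxform X x z - mxform X y z.
Proof. by rewrite /mxform raddfB /= !mulmxBl !mxE. Qed.

Lemma mxformBr X x y z : mxform X x (y - z) = mxform X x y - mxform X x z.
Proof. by rewrite /mxform mulmxBr !mxE. Qed.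

Lemma mxformZl a X x y : mxform X (a *: x) y = a * mxform X x y.
Proof. by rewrite /mxform linearZ /= -!scalemxAl mxE. Qed.

Lemma mxformZr a X x y : mxform X x (a *: y) = a * mxform X x y.
Proof. by rewrite /mxform -scalemxAr mxE. Qed.

End MatrixForm.

Section PositiveSemidefinite.
Context {R : realType} {d : nat}.
Implicit Types X Y : 'M[R]_d.

Lemma psdmx_form_ge0 X x : psdmx X -> 0 <= mxform X x x.
Proof. by case=> _; apply. Qed.

Lemma psdmx0 : psdmx (0 : 'M[R]_d).
Proof. by split=> [|x]; rewrite ?trmx0 // mulmx0 mul0mx mxE. Qed.

Lemma psdmx1 : psdmx (1%:M : 'M[R]_d).
Proof. by split=> [|x]; rewrite ?trmx1 // mulmx1 cV_sqnorm_ge0. Qed.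

Lemma psdmxD X Y : psdmx X -> psdmx Y -> psdmx (X + Y).
Proof.
move=> pX pY; split=> [|x]; first by rewrite raddfD /= pX.1 pY.1.
by rewrite -/(mxform _ x x) mxformD addr_ge0 ?psdmx_form_ge0.
Qed.

Lemma psdmx_congr p X (B : 'M[R]_(d, p)) : psdmx X -> psdmx (B^T *m X *m B).
Proof.
move=> pX; split=> [|x]; first by rewrite !trmx_mul trmxK pX.1 mulmxA.
by rewrite -/(mxform _ x x) mxform_congr psdmx_form_ge0.
Qed.

Lemma psdmx_CauchySchwarz X x y : psdmx X ->
  mxform X x y ^+ 2 <= mxform X x x * mxform X y y.
Proof.
move=> pX; set a := mxform X x x; set b := mxform X x y; set c := mxform X y y.
pose q : {poly R} := \poly_(i < 3) [:: c; - (2 * b); a]`_i.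
have q_ge0 t : 0 <= q.[t].
  suff -> : q.[t] = mxform X (t *: x - y) (t *: x - y) by apply: psdmx_form_ge0.
  have yXx : mxform X y x = b by rewrite -mxform_tr pX.1.
  rewrite horner_poly !big_ord_recr big_ord0 /=.
  by rewrite !(mxformBl, mxformBr, mxformZl, mxformZr) yXx -/a -/b -/c; ring.
have := deg_le2_poly_ge0 (size_poly _ _) q_ge0; rewrite !coef_poly /=.
have -> : (- (2 * b)) ^+ 2 - 4 * a * c = 4 * (b ^+ 2 - a * c) by ring.
by rewrite pmulr_rle0 // subr_le0.
Qed.

Lemma psdmx_form_eq0 X x : psdmx X -> mxform X x x = 0 -> X *m x = 0.
Proof.
move=> pX xXx0; apply/eqP; rewrite -cV_sqnorm_eq0.
have := psdmx_CauchySchwarz x (X *m x) pX.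
by rewrite xXx0 mul0r exprn_even_le0 //= /mxform -{1}pX.1 -trmx_mul.
Qed.

Lemma psdmxD_kerl X Y p (A : 'M[R]_(d, p)) : psdmx X -> psdmx Y ->
  (X + Y) *m A = 0 -> X *m A = 0.
Proof.
move=> pX pY XYA0; apply/matrixP => i j.
suff /matrixP/(_ i 0) : X *m (A *m delta_mx j 0 : 'cV_d) = 0.
  by rewrite mulmxA -colE !mxE.
set x := A *m _; apply: psdmx_form_eq0 => //; apply/eqP.
have : mxform (X + Y) x x == 0.
  by rewrite mxformE [_ *m x]mulmxA XYA0 mul0mx mulmx0 mxE.
by rewrite mxformD paddr_eq0 ?psdmx_form_ge0 // => /andP[].
Qed.

Lemma psdmxD_submxl X Y : psdmx X -> psdmx Y -> (X <= (X + Y)%R)%MS.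
Proof.
by move=> pX pY; rewrite submxE; apply/eqP/(psdmxD_kerl pX pY)/mulmx_coker.
Qed.

End PositiveSemidefinite.

Section MoorePenrose.
Context {R : realType} {m n : nat}.
Implicit Type X : 'M[R]_(m, n).

Lemma mpinv_tr X : mpinv X^T = (mpinv X)^T.
Proof.
have [XYX YXY XYs YXs] := mpinvP X.
apply: mpinv_uniq (mpinvP _) _; split; rewrite -!trmx_mul ?mulmxA.
- by rewrite XYX.
- by rewrite YXY.
- by rewrite !YXs.
- by rewrite !XYs.
Qed.

Lemma mulmx_mpinvK p X (A : 'M[R]_(p, n)) :
  (A <= X)%MS -> A *m mpinv X *m X = A.
Proof.
case/submxP=> D ->; have [XYX _ _ _] := mpinvP X.
by rewrite -[in RHS]XYX !mulmxA.
Qed.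

End MoorePenrose.

Section ParallelSum.
Context {R : realType} {d : nat}.
Variables X Y : 'M[R]_d.
Hypotheses (pX : psdmx X) (pY : psdmx Y).

Let S := X + Y.

Lemma mpinv_psdmxD_tr : (mpinv S)^T = mpinv S.
Proof. by rewrite -mpinv_tr (psdmxD pX pY).1. Qed.

Lemma mul_mpinv_psdmxDl : X *m mpinv S *m S = X.
Proof. exact: mulmx_mpinvK (psdmxD_submxl pX pY). Qed.

Lemma mul_mpinv_psdmxDr : Y *m mpinv S *m S = Y.
Proof. by rewrite /S addrC mulmx_mpinvK // psdmxD_submxl. Qed.

Lemma parallel_sumE : parallel_sum X Y = X - X *m mpinv S *m X.
Proof.
by rewrite -[A in A - _]mul_mpinv_psdmxDl mulmxDr addrAC subrr add0r.
Qed.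

Lemma parallel_sum_tr : (parallel_sum X Y)^T = parallel_sum X Y.
Proof.
by rewrite parallel_sumE raddfB /= !trmx_mul mpinv_psdmxD_tr pX.1 mulmxA.
Qed.

Lemma parallel_sumC : parallel_sum X Y = parallel_sum Y X.
Proof.
rewrite -parallel_sum_tr /parallel_sum !trmx_mul mpinv_psdmxD_tr pX.1 pY.1.
by rewrite [Y + X]addrC mulmxA.
Qed.

Lemma psdmx_parallel_sum : psdmx (parallel_sum X Y).
Proof.
pose B := mpinv S *m Y; pose C := mpinv S *m X.
suff -> : parallel_sum X Y = B^T *m X *m B + C^T *m Y *m C.
  by apply: psdmxD; apply: psdmx_congr.
have YSX : Y *m mpinv S *m X = parallel_sum X Y.
  by rewrite parallel_sumC /parallel_sum [Y + X]addrC.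
rewrite !trmx_mul mpinv_psdmxD_tr pX.1 pY.1 YSX -/(parallel_sum X Y).
rewrite !mulmxA -mulmxDr [Y + X]addrC {2}/parallel_sum.
by rewrite -!mulmxA [Y *m (_ *m _)]mulmxA mul_mpinv_psdmxDr mulmxA.
Qed.

Lemma parallel_sum_ker p (A B : 'M[R]_(d, p)) :
  X *m A = 0 -> Y *m B = 0 -> parallel_sum X Y *m (A + B) = 0.
Proof.
move=> XA YB; rewrite mulmxDr {1}parallel_sumC /parallel_sum.
by rewrite -!mulmxA XA YB !mulmx0 addr0.
Qed.

End ParallelSum.

Section Decision.
Context {R : realType} {d : nat}.
Implicit Type X : 'M[R]_d.

Lemma decisionE X : decision X = if X \in unitmx then 1%:M else X.
Proof.
rewrite -row_full_unit /row_full /decision; case: ifP => // _.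
by case: eqP => [->|].
Qed.

Lemma decision0 : decision (0 : 'M[R]_d) = 0.
Proof. by rewrite decisionE; case: ifP => // /mulVmx <-; rewrite mulmx0. Qed.

Lemma psdmx_decision X : psdmx X -> psdmx (decision X).
Proof. by rewrite decisionE; case: ifP => // _ _; apply: psdmx1. Qed.

Lemma decision_ker p X (A : 'M[R]_(d, p)) : X *m A = 0 -> decision X *m A = 0.
Proof.
rewrite decisionE; case: ifP => // uX XA.
by rewrite mul1mx -(mulKmx uX A) XA mulmx0.
Qed.

End Decision.

Lemma blk_dimE (n d : nat) : (\sum_(i < n) d = d * n)%N.
Proof. by rewrite sum_nat_const card_ord mulnC. Qed.

Section Blocks.
Context {R : realType} {n d : nat}.

Lemma block_of_blocks (B : 'I_n -> 'I_n -> 'M[R]_d) i j :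
  block (of_blocks B) i j = B i j.
Proof. exact: mxblockK. Qed.

Lemma block1 i j : block (1%:M : blkmx R n d) i j = if i == j then 1%:M else 0.
Proof.
rewrite /block -[1%:M]mxdiagZ /mxdiag mxblockK.
by case: eqP => // _; rewrite conform_mx_id.
Qed.

Record composable_blocks (P : 'I_n -> 'I_n -> 'M[R]_d -> Prop) : Prop := {
  composable1 : forall i, P i i 1%:M;
  composable0 : forall i j, P i j 0;
  composableD : forall i j X Y, P i j X -> P i j Y -> P i j (X + Y);
  composable_parallel_sum : forall i k j X Y,
    P i k X -> P k j Y -> P i j (parallel_sum X Y);
  composable_decision : forall i j X, P i j X -> P i j (decision X)
}.

Variable P : 'I_n -> 'I_n -> 'M[R]_d -> Prop.
Hypothesis compP : composable_blocks P.

Lemma composable_block1 i j : P i j (block 1%:M i j).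
Proof.
rewrite block1; case: eqP => [->|_]; [exact: composable1|exact: composable0].
Qed.

Lemma composable_blk_power (X : blkmx R n d) k :
  (forall i j, P i j (block X i j)) ->
  forall i j, P i j (block (blk_power X k) i j).
Proof.
move=> PX; have PD i j : P i j (block (blk_decision X) i j).
  by rewrite block_of_blocks; apply: composable_decision.
elim: k => [|[|k] IH] i j //=; first exact: composable_block1.
rewrite !block_of_blocks; apply: composable_decision => //.
apply: (big_ind (P i j)) => [|Y Z|l _]; [exact: composable0 |
  exact: composableD | exact: (composable_parallel_sum compP (k := l))].
Qed.

Lemma composable_Mmx (G : mwgraph R n d) k :
  (forall i j, P i j (weight G i j)) -> forall i j, P i j (block (Mmx G k) i j).
Proof.
move=> PW; have PA i j : P i j (block (adjacency G) i j).
  by rewrite block_of_blocks.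
elim: k => [|k IH] i j; first exact: composable_block1.
rewrite [Mmx _ _]/= !block_of_blocks; apply: composable_decision => //.
by apply: composableD => //; apply: (composable_blk_power k.+1).
Qed.

End Blocks.

Section Laplacian.
Context {R : realType} {n d : nat}.
Variable G : mwgraph R n d.

Lemma mul_laplacian_mxcol m (y : 'I_n -> 'M[R]_(d, m)) :
  laplacian G *m \mxcol_i y i = \mxcol_i \sum_j weight G i j *m (y i - y j).
Proof.
rewrite mulmxBl mul_mxdiag_mxcol mul_mxblock_mxrow -mxcolB.
apply: eq_mxcol => i; rewrite mulmx_suml -sumrB.
by apply: eq_bigr => j _; rewrite mulmxBr.
Qed.

Definition dirichlet_energy (y : 'I_n -> 'cV[R]_d) : R :=
  \sum_i \sum_j mxform (weight G i j) (y i - y j) (y i - y j).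

Lemma mxform_laplacian y : mxform (laplacian G) (\mxcol_i y i) (\mxcol_i y i) =
  \sum_i \sum_j mxform (weight G i j) (y i) (y i - y j).
Proof.
rewrite mxformE mul_laplacian_mxcol tr_mxcol mul_mxrow_mxcol summxE.
apply: eq_bigr => i _; rewrite mulmx_sumr summxE.
by apply: eq_bigr => j _; rewrite mxformE.
Qed.

Lemma dirichlet_energyE y : dirichlet_energy y =
  mxform (laplacian G) (\mxcol_i y i) (\mxcol_i y i) *+ 2.
Proof.
rewrite mxform_laplacian mulr2n [X in _ + X]exchange_big -big_split /=.
apply: eq_bigr => i _; rewrite -big_split; apply: eq_bigr => j _ /=.
by rewrite (weight_sym G j i) !(mxformBl, mxformBr); ring.
Qed.

Lemma dirichlet_energy_eq0 y : dirichlet_energy y = 0 ->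
  forall i j, weight G i j *m (y i - y j) = 0.
Proof.
have energy_ge0 i j : 0 <= mxform (weight G i j) (y i - y j) (y i - y j).
  exact/psdmx_form_ge0/weight_psd.
move=> /eqP; rewrite psumr_eq0 => [/allP E0 i j|i _]; last exact: sumr_ge0.
apply/psdmx_form_eq0/eqP; first exact: weight_psd.
have := E0 i (mem_index_enum _).
by rewrite psumr_eq0 // => /allP/(_ j (mem_index_enum _)).
Qed.

Lemma laplacian_ker_weight (y : 'I_n -> 'cV[R]_d) :
  laplacian G *m \mxcol_i y i = 0 ->
  forall i j, weight G i j *m (y i - y j) = 0.
Proof.
move=> Ly; apply: dirichlet_energy_eq0.
by rewrite dirichlet_energyE mxformE Ly mulmx0 mxE mul0rn.
Qed.

End Laplacian.

Section Cluster.
Context {R : realType} {n d : nat}.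

Definition psd_annihilator m (y : 'I_n -> 'M[R]_(d, m)) (i j : 'I_n)
    (X : 'M[R]_d) : Prop :=
  psdmx X /\ X *m (y i - y j) = 0.

Lemma composable_psd_annihilator m (y : 'I_n -> 'M[R]_(d, m)) :
  composable_blocks (psd_annihilator y).
Proof.
split=> [i|i j|i j X Y [pX Xy] [pY Yy]|i k j X Y [pX Xy] [pY Yy]|i j X [pX Xy]].
- by split; [exact: psdmx1 | rewrite subrr mulmx0].
- by split; [exact: psdmx0 | rewrite mul0mx].
- by split; [exact: psdmxD | rewrite mulmxDl Xy Yy addr0].
- split; first exact: psdmx_parallel_sum.
  by rewrite -(subrKA (y k)) parallel_sum_ker.
- by split; [exact: psdmx_decision | exact: decision_ker].
Qed.

Variable G : mwgraph R n d.

Lemma Mmx_block1_same_cluster k i j :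
  block (Mmx G k) i j = 1%:M -> same_cluster G i j.
Proof.
move=> M1 x Lx; pose y l := @submxcol R n (fun=> d) 1 x l.
apply/subr0_eq; have [_] : psd_annihilator y i j (block (Mmx G k) i j).
  apply: composable_Mmx => [|{M1}{}i {}j].
    exact: composable_psd_annihilator.
  split; first exact: weight_psd.
  by apply: laplacian_ker_weight; rewrite submxcolK.
by rewrite M1 mul1mx.
Qed.

Lemma same_cluster_submxcol i j m (x : 'M[R]_(\sum_(i < n) d, m)) :
  same_cluster G i j -> laplacian G *m x = 0 ->
  @submxcol R n (fun=> d) m x i = @submxcol R n (fun=> d) m x j.
Proof.
move=> ij Lx; apply/matrixP => a b.
have /ij/colP/(_ a) : laplacian G *m col b x = 0.
  by rewrite colE mulmxA Lx mul0mx.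
by rewrite !mxE.
Qed.

End Cluster.

Section Consensus.
Context {R : realType} {n d : nat}.

Definition consensus_mx : 'M[R]_(\sum_(i < n) d, d) := \mxcol_(i < n) 1%:M.

Lemma mul_consensus_mx m (z : 'M[R]_(d, m)) :
  consensus_mx *m z = \mxcol_(i < n) z.
Proof. by rewrite mxcol_mul; apply: eq_mxcol => i; rewrite mul1mx. Qed.

Lemma mxrank_consensus_mx : (0 < n)%N -> \rank consensus_mx = d.
Proof.
move=> n_gt0; pose i0 := Ordinal n_gt0.
apply/eqP/row_fullP; exists (\mxrow_(i < n) ((i == i0)%:R%:M : 'M[R]_d)).
rewrite mul_mxrow_mxcol (bigD1 i0) //= mulmx1 big1 ?addr0 //.
by move=> i /negPf->; rewrite raddf0 mul0mx.
Qed.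

Variable G : mwgraph R n d.

Lemma mul_laplacian_consensus_mx : laplacian G *m consensus_mx = 0.
Proof.
rewrite mul_laplacian_mxcol -[RHS]mxcol0; apply: eq_mxcol => i.
by rewrite big1 // => j _; rewrite subrr mulmx0.
Qed.

Lemma mxrank_laplacian_le : (\rank (laplacian G) <= d * n - d)%N.
Proof.
have [n0|n_gt0] := posnP n.
  by apply: leq_trans (rank_leq_row _) _; rewrite blk_dimE n0 muln0.
have /(leq_sub2r d) := mulmx0_rank_max mul_laplacian_consensus_mx.
by rewrite mxrank_consensus_mx // addnK -blk_dimE.
Qed.

Lemma mxrank_laplacian_ge :
  (forall i j, same_cluster G i j) -> (d * n - d <= \rank (laplacian G))%N.
Proof.
move=> clG; have [n0|n_gt0] := posnP n.
  by apply: leq_trans (leq0n _); rewrite n0 muln0.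
set C := cokermx (laplacian G).
set C0 := @submxcol R n (fun=> d) _ C (Ordinal n_gt0).
have C_consensus : C = consensus_mx *m C0.
  rewrite mul_consensus_mx -[LHS](@submxcolK _ _ (fun=> d)).
  apply: eq_mxcol => i.
  by apply: same_cluster_submxcol => //; apply: mulmx_coker.
rewrite leq_subLR addnC -leq_subLR -blk_dimE -mxrank_coker -/C C_consensus.
exact: leq_trans (mxrankM_maxl _ _) (rank_leq_col _).
Qed.

Lemma same_cluster_connected :
  (forall i j, same_cluster G i j) -> mw_connected G.
Proof.
move=> clG; apply/anti_leq.
by rewrite mxrank_laplacian_le mxrank_laplacian_ge.
Qed.

End Consensus.

Section Paths.
Context {R : realType} {n d : nat}.

Definition vanishes_off (e : rel 'I_n) (i j : 'I_n) (X : 'M[R]_d) : Prop :=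
  ~~ e i j -> X = 0.

Lemma composable_vanishes_off (e : rel 'I_n) :
  reflexive e -> transitive e -> composable_blocks (vanishes_off e).
Proof.
move=> e_refl e_trans; split.
- by move=> i; rewrite /vanishes_off e_refl.
- by [].
- by move=> i j X Y X0 Y0 ij; rewrite X0 // Y0 // addr0.
- move=> i k j X Y X0 Y0 ij; rewrite /parallel_sum.
  have [ik|/X0->] := boolP (e i k); last by rewrite !mul0mx.
  have [kj|/Y0->] := boolP (e k j); last by rewrite mulmx0.
  by rewrite (e_trans _ _ _ ik kj) in ij.
- by move=> i j X X0 ij; rewrite X0 // decision0.
Qed.

Variable G : mwgraph R n d.

Lemma path_joinsP i j : reflect (path_joins G i j) (connect (edge G) i j).
Proof.
apply: (iffP connectP) => [[p ep ->]|[p [ep _ <-]]]; last by exists p.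
by case: (shortenP ep) => q eq uq _; exists q.
Qed.

Lemma Mmx_block_disconnected k i j :
  ~~ connect (edge G) i j -> block (Mmx G k) i j = 0.
Proof.
apply: (composable_Mmx (P := vanishes_off (connect (edge G)))).
  exact: composable_vanishes_off (@connect0 _ _) (@connect_trans _ _).
move => {}i {}j nij.
by apply: weight_nonedge; apply: contra nij; apply: connect1.
Qed.

End Paths.

Theorem theorem2 (R : realType) (n d : nat) (G : mwgraph R n d) :
  (forall i j : 'I_n,
     (exists k : nat, (k <= n.-1)%N /\ block (Mmx G k) i j = 1%:M) ->
     same_cluster G i j)
  /\
  ((Mmx G n.-1 = kron ((const_mx 1 : 'cV[R]_n) *m (const_mx 1 : 'cV[R]_n)^T)
                      (1%:M : 'M[R]_d) ->
    mw_connected G)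
   /\
   (forall i j : 'I_n, ~ path_joins G i j ->
      block (Mmx G n.-1) i j = 0 /\ block (Mmx G n.-1) j i = 0)).
Proof.
split=> [i j [k [_ Mk]]|]; first exact: Mmx_block1_same_cluster Mk.
split=> [M1|i j /path_joinsP nij].
  apply: same_cluster_connected => i j.
  apply: (Mmx_block1_same_cluster (k := n.-1)).
  by rewrite M1 block_of_blocks !mxE big_ord1 !mxE mulr1 scale1r.
have nji : ~~ connect (edge G) j i by rewrite (sym_connect_sym (edge_sym G)).
by split; apply: Mmx_block_disconnected.
Qed.
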